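(* Let $R$ be a finite ring. Then $T_{R^\times}=\sum_{u\in R^\times}u\neq 0$ if and only if $R$ is one of the following rings: (1) $2=0$ in $R$, $|\mathrm{Rad}(R)|=2$ and $R/\mathrm{Rad}(R)\cong\prod_{i=1}^dF_i$ where each $F_i$ is a finite field of characteristic $2$. In this case, $T_{R^\times}=e$ where $e$ is the unique non-zero element in $\mathrm{Rad}(R)$. (2) $\mathrm{Rad}(R)=0$ and $R\cong\mathbb{F}_2^r\times\left(\prod_{i=1}^tF_i\right)$ where $r\geq 1$, $F_i$ is a finite field of characteristic $2$ and $|F_i|>2$ for each $1\leq i\leq t$. In this case, $T_{R^\times}=(1_{\mathbb{F}_2^r},0)$.
   Context: Rings are finite, unital, with $0\neq 1$, not necessarily commutative. $R^\times$ is the unit group and $\mathrm{Rad}(R)$ the Jacobson radical of $R$. In (2), $t=0$ (no factors $F_i$) is allowed, and the value of $T_{R^\times}$ is understood via the isomorphism. *)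

(* Defs.v *)
From HB Require Import structures.
From mathcomp Require Import all_boot all_algebra.

Set Implicit Arguments.
Unset Strict Implicit.
Unset Printing Implicit Defensive.

Import GRing.Theory.
Local Open Scope ring_scope.
Local Open Scope quotient_scope.

Section LeftIdeals.
Variable R : finNzRingType.
Implicit Types I J : {set R}.

Definition left_ideal I :=
  (0 \in I) && [forall a, forall u in I, forall v in I, a * u + v \in I].

Definition max_left_ideal I :=
  maxset (fun J : {set R} => left_ideal J && (J != [set: R])) I.

Definition jacobson : {set R} := \bigcap_(I : {set R} | max_left_ideal I) I.

Lemma left_idealP I :
  reflect (0 \in I /\ forall a, {in I &, forall u v, a * u + v \in I})
          (left_ideal I).
Proof.
apply: (iffP andP) => -[I0 H]; split=> //.
  by move=> a u v uI vI; move/forallP/(_ a)/forall_inP/(_ _ uI)/forall_inP: H; apply.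
apply/forallP=> a; apply/forall_inP=> u uI; apply/forall_inP=> v vI.
exact: H.
Qed.

Lemma left_ideal_setT I : left_ideal I -> 1 \in I -> I = [set: R].
Proof.
case/left_idealP=> I0 IM I1; apply/setP=> x.
by rewrite in_setT -[x]mulr1 -[_ * _]addr0 IM.
Qed.

Lemma max_left_ideal_ideal I : max_left_ideal I -> left_ideal I.
Proof. by case/maxsetP=> /andP[]. Qed.

Lemma jacobsonP x :
  reflect (forall I, max_left_ideal I -> x \in I) (x \in jacobson).
Proof. exact: bigcapP. Qed.

Lemma jacobson0 : 0 \in jacobson.
Proof. by apply/jacobsonP=> I /max_left_ideal_ideal/left_idealP[]. Qed.

Lemma jacobson_lin a : {in jacobson &, forall u v, a * u + v \in jacobson}.
Proof.
move=> u v /jacobsonP uJ /jacobsonP vJ; apply/jacobsonP=> I mI.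
by case/left_idealP: (max_left_ideal_ideal mI) => _; apply; [apply: uJ|apply: vJ].
Qed.

Lemma jacobson_mull a u : u \in jacobson -> a * u \in jacobson.
Proof. by move=> uJ; rewrite -[_ * _]addr0 jacobson_lin ?jacobson0. Qed.

(* The residual [M : r] of a maximal left ideal is maximal or everything,
   so the intersection of the maximal left ideals is two-sided. *)
Lemma max_left_ideal_res M r :
  max_left_ideal M -> r \notin M -> max_left_ideal [set x | x * r \in M].
Proof.
move=> mM rM; have /left_idealP[M0 ML] := max_left_ideal_ideal mM.
case/maxsetP: (mM) => _ maxM.
have MD u v : u \in M -> v \in M -> u + v \in M.
  by move=> uM vM; rewrite -[u]mul1r ML.
have MN u : u \in M -> - u \in M.
  by move=> uM; rewrite -mulN1r -[_ * _]addr0 ML.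
apply/maxsetP; split.
  apply/andP; split.
    apply/left_idealP; split=> [|a u v]; rewrite !inE ?mul0r // => uM vM.
    by rewrite mulrDl -mulrA ML.
  by apply/negP=> /eqP/setP/(_ 1); rewrite !inE mul1r (negPf rM).
move=> N /andP[/left_idealP[N0 NL] NT] sMN.
apply/eqP; rewrite eqEsubset sMN andbT; apply/subsetP=> n nN; rewrite inE.
pose K := [set y | [exists z in N, y - z * r \in M]].
have KL : left_ideal K.
  apply/left_idealP; split.
    by rewrite inE; apply/exists_inP; exists 0; rewrite // mul0r subr0.
  move=> a u v; rewrite !inE => /exists_inP[y yN uM] /exists_inP[z zN vM].
  apply/exists_inP; exists (a * y + z); first exact: NL.
  rewrite mulrDl -mulrA opprD addrACA -mulrBr; exact: ML.
have sMK : M \subset K.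
  by apply/subsetP=> y yM; rewrite inE; apply/exists_inP; exists 0;
     rewrite // mul0r subr0.
have [KT | KnT] := eqVneq K [set: R].
  have : r \in K by rewrite KT in_setT.
  rewrite inE => /exists_inP[z zN]; rewrite -{1}[r]mul1r -mulrBl => zM.
  have N1 : 1 \in N.
    have /(NL 1 z (1 - z) zN) : 1 - z \in N by apply: (subsetP sMN); rewrite inE.
    by rewrite mul1r addrC subrK.
  case/negP: NT; apply/eqP; apply: left_ideal_setT N1; exact/left_idealP.
have <- : K = M by apply: maxM; rewrite ?KL.
by rewrite inE; apply/exists_inP; exists n; rewrite // subrr.
Qed.

Lemma jacobson_mulr a u : u \in jacobson -> u * a \in jacobson.
Proof.
move=> /jacobsonP uJ; apply/jacobsonP=> I mI.
have [aI | aI] := boolP (a \in I).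
  have /left_idealP[I0 IL] := max_left_ideal_ideal mI.
  by rewrite -[_ * _]addr0 IL.
by have := uJ _ (max_left_ideal_res mI aI); rewrite inE.
Qed.

Lemma jacobson1 : 1 \notin jacobson.
Proof.
have P0 : left_ideal [set 0] && ([set 0] != [set: R]).
  apply/andP; split.
    apply/left_idealP; split=> [|a u v]; rewrite !inE //.
    by move=> /eqP-> /eqP->; rewrite mulr0 addr0.
  by apply/negP=> /eqP/setP/(_ 1); rewrite !inE oner_eq0.
have [M mM _] := @maxset_exists _ (fun J => left_ideal J && (J != setT)) _ P0.
apply/negP=> /jacobsonP/(_ M mM) M1.
have /andP[ML /negP[]] := maxsetp mM.
by apply/eqP; apply: left_ideal_setT.
Qed.

Definition jacobson_pred : {pred R} := fun x => x \in jacobson.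

Lemma jacobson_zmod_closed : zmod_closed jacobson_pred.
Proof.
split=> [|x y xJ yJ]; first exact: jacobson0.
by rewrite -mulN1r addrC; apply: jacobson_lin.
Qed.

HB.instance Definition _ :=
  GRing.isZmodClosed.Build R jacobson_pred jacobson_zmod_closed.

End LeftIdeals.

Section QuotientRing.
Variable R : finNzRingType.

(* The library puts a ring structure on [Quotient.quot] for commutative rings
   only; as an additive group the quotient below is the library's. *)
Definition quo_jacobson := Quotient.quot (@jacobson_pred R).

HB.instance Definition _ :=
  ZmodQuotient.copy quo_jacobson (Quotient.quot (@jacobson_pred R)).

Let equivJ := Quotient.equiv (@jacobson_pred R).

Lemma quo_jacobson_eq (x y : R) :
  (x == y %[mod quo_jacobson]) = (x - y \in jacobson R).
Proof. by rewrite -(Quotient.idealrBE (@jacobson_pred R)). Qed.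

Definition quo_one : quo_jacobson := \pi_quo_jacobson 1.
Definition quo_mul (x y : quo_jacobson) : quo_jacobson :=
  \pi_quo_jacobson (repr x * repr y).

Lemma quo_pi_mul : {morph \pi_quo_jacobson : x y / x * y >-> quo_mul x y}.
Proof.
move=> x y; apply/eqP; rewrite /quo_mul quo_jacobson_eq.
set x' := repr _; set y' := repr _.
have xx' : x - x' \in jacobson R by rewrite -quo_jacobson_eq reprK.
have yy' : y - y' \in jacobson R by rewrite -quo_jacobson_eq reprK.
have -> : x * y - x' * y' = x * (y - y') + (x - x') * y'.
  by rewrite mulrBr mulrBl addrA subrK.
exact: jacobson_lin yy' (jacobson_mulr _ xx').
Qed.

Lemma quo_mulA : associative quo_mul.
Proof.
move=> x y z; elim/quotW: x => x; elim/quotW: y => y; elim/quotW: z => z.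
by rewrite -(quo_pi_mul y z) -(quo_pi_mul x y) -!quo_pi_mul mulrA.
Qed.

Lemma quo_mul1 : left_id quo_one quo_mul.
Proof. by move=> x; elim/quotW: x => x; rewrite -quo_pi_mul mul1r. Qed.

Lemma quo_mulr1 : right_id quo_one quo_mul.
Proof. by move=> x; elim/quotW: x => x; rewrite -quo_pi_mul mulr1. Qed.

Lemma quo_mulDl : left_distributive quo_mul +%R.
Proof.
move=> x y z; elim/quotW: x => x; elim/quotW: y => y; elim/quotW: z => z.
by rewrite -!quo_pi_mul -!(raddfD \pi_quo_jacobson) -quo_pi_mul mulrDl.
Qed.

Lemma quo_mulDr : right_distributive quo_mul +%R.
Proof.
move=> x y z; elim/quotW: x => x; elim/quotW: y => y; elim/quotW: z => z.
by rewrite -!quo_pi_mul -!(raddfD \pi_quo_jacobson) -quo_pi_mul mulrDr.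
Qed.

Lemma quo_one_neq0 : quo_one != 0.
Proof.
by rewrite -(raddf0 \pi_quo_jacobson) quo_jacobson_eq subr0 jacobson1.
Qed.

HB.instance Definition _ := GRing.Zmodule_isNzRing.Build quo_jacobson
  quo_mulA quo_mul1 quo_mulr1 quo_mulDl quo_mulDr quo_one_neq0.

HB.instance Definition _ := @isNzRingQuotient.Build
  R equivJ 0 -%R +%R 1 *%R quo_jacobson (erefl _) quo_pi_mul.

End QuotientRing.

Section ProductRing.
Variables (I : finType) (F : I -> pzRingType).

Definition prod_ring := {dffun forall i, F i}.

HB.instance Definition _ := Choice.on prod_ring.

Implicit Types f g h : prod_ring.

Definition prod_zero : prod_ring := [ffun i => 0 : F i].
Definition prod_opp f : prod_ring := [ffun i => - f i].
Definition prod_add f g : prod_ring := [ffun i => f i + g i].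
Definition prod_one : prod_ring := [ffun i => 1 : F i].
Definition prod_mul f g : prod_ring := [ffun i => f i * g i].

Fact prod_addA : associative prod_add.
Proof. by move=> f g h; apply/ffunP=> i; rewrite !ffunE addrA. Qed.
Fact prod_addC : commutative prod_add.
Proof. by move=> f g; apply/ffunP=> i; rewrite !ffunE addrC. Qed.
Fact prod_add0 : left_id prod_zero prod_add.
Proof. by move=> f; apply/ffunP=> i; rewrite !ffunE add0r. Qed.
Fact prod_addN : left_inverse prod_zero prod_opp prod_add.
Proof. by move=> f; apply/ffunP=> i; rewrite !ffunE addNr. Qed.

HB.instance Definition _ :=
  GRing.isZmodule.Build prod_ring prod_addA prod_addC prod_add0 prod_addN.

Fact prod_mulA : associative prod_mul.
Proof. by move=> f g h; apply/ffunP=> i; rewrite !ffunE mulrA. Qed.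
Fact prod_mul1 : left_id prod_one prod_mul.
Proof. by move=> f; apply/ffunP=> i; rewrite !ffunE mul1r. Qed.
Fact prod_mulr1 : right_id prod_one prod_mul.
Proof. by move=> f; apply/ffunP=> i; rewrite !ffunE mulr1. Qed.
Fact prod_mulDl : left_distributive prod_mul prod_add.
Proof. by move=> f g h; apply/ffunP=> i; rewrite !ffunE mulrDl. Qed.
Fact prod_mulDr : right_distributive prod_mul prod_add.
Proof. by move=> f g h; apply/ffunP=> i; rewrite !ffunE mulrDr. Qed.

HB.instance Definition _ := GRing.Zmodule_isPzRing.Build prod_ring
  prod_mulA prod_mul1 prod_mulr1 prod_mulDl prod_mulDr.

End ProductRing.

Definition ring_isomorphic (A B : pzRingType) :=
  exists phi : {rmorphism A -> B}, bijective phi.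

Definition unit_sum (R : finUnitRingType) : R :=
  \sum_(u : R | u \is a GRing.unit) u.

Definition nonsemisimple_case (R : finUnitRingType) :=
  [/\ 2%:R = 0 :> R,
      #|jacobson R| = 2%N
    & exists (d : nat) (F : 'I_d -> finFieldType),
        (forall i, 2%N \in [pchar (F i)]) /\
        ring_isomorphic (quo_jacobson R) (prod_ring (fun i => F i))].

Definition semisimple_model (r t : nat) (F : 'I_t -> finFieldType) :=
  ({ffun 'I_r -> 'F_2} * prod_ring (fun i => F i))%type.

Definition semisimple_data (R : finUnitRingType) (r t : nat)
    (F : 'I_t -> finFieldType) :=
  [/\ jacobson R = [set 0],
      (1 <= r)%N
    & forall i, (2%N \in [pchar (F i)]) /\ (2 < #|F i|)%N].

Definition semisimple_case (R : finUnitRingType) :=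
  exists (r t : nat) (F : 'I_t -> finFieldType),
    semisimple_data R r F /\ ring_isomorphic R (semisimple_model r F).

(* Main.v *)
Require Import Defs.
From HB Require Import structures.
From mathcomp Require Import all_boot all_algebra.
From mathcomp Require Import fingroup morphism quotient cyclic pgroup finfield.

(** Write T for the sum of the units of R and J for the Jacobson radical.

    If 2 <> 0, the units cancel in pairs {u, - u}, so T <> 0 forces 2 = 0.
    Let then e be a nonzero element of J.  The map u |-> u + e is a
    fixed-point-free involution of the units and each pair {u, u + e} has
    sum e, whence T = (|R^x| / 2) e ([unit_sum_jacobson]).  So every nonzero
    element of J equals T as soon as T <> 0, and J has at most two elements
    ([jacobson_unit_sum_neq0]).

    The second ingredient is parity.  The subgroup 1 + J of R^x has |J|
    elements, and by Cauchy's theorem its index is odd exactly when R / J is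
    reduced ([odd_index_principal_units]): a class u of order two yields
    (u - 1)^2 = u^2 - 1 in J with u - 1 outside J, and conversely x^2 in J
    with x outside J yields the class 1 + x of order two.
    - If |J| = 2, the formula above reads T = |R^x : 1 + J| e, so T <> 0 if
      and only if R / J is reduced, and then T = e.
    - If J = 0 and |R^x| is even, then T T = |R^x| T = 0 since u T = T for all
      units u; moreover T annihilates every x with x^2 = 0, because
      1 + x is a unit.  From these two facts every product r T is
      nilpotent, so T lies in J = 0 ([unit_sum_even_jacobson]).  Hence
      T <> 0 forces |R^x| odd, that is, R reduced.

    A finite reduced ring is a product of finite fields
    ([reduced_prod_fields]): its idempotents are central, its primitive
    idempotents are orthogonal with sum 1, each corner e S is a finite domain,
    and finite domains are fields by Wedderburn's little theorem.  This gives
    the description of R / J, which is R itself when J = 0; in that case the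
    factors with two elements are gathered into a power of F_2.

    Finally let R be a product of fields of characteristic 2.  In a factor with
    more than two elements, a T = T for some a <> 0, 1, so the component of
    T vanishes; in a factor F_2 all units have component 1, so the component
    of T is the parity of |R^x|, which is 1 ([semisimple_unit_sum]).  Thus
    T = (1, 0), and T <> 0 exactly when some factor is F_2. *)

Set Implicit Arguments.
Unset Strict Implicit.
Unset Printing Implicit Defensive.

Import GRing.Theory.
Local Open Scope ring_scope.

(** * Pairing, idempotent powers and the radical of a finite ring *)

(** The common source of the two cancellations: [f := -%R] with [c := 0], and
    [f := +%R^~ e] with [c := e] for [e] in the radical. *)
Lemma sum_paired (T : finType) (V : nmodType) (f : T -> T) (F : T -> V) (c : V)
    (A : {set T}) :
  involutive f ->
  (forall x, x \in A -> [/\ f x \in A, f x != x & F x + F (f x) = c]) ->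
  \sum_(x in A) F x = c *+ #|A|./2.
Proof.
move=> fK; have [n] := ubnP #|A|; elim: n => // n IHn in A * => ltAn fA.
have [->|[x xA]] := set_0Vmem A; first by rewrite big_set0 cards0.
have [fxA fxx Fx] := fA x xA.
have fxA' : f x \in A :\ x by rewrite !inE fxx.
have eqA : #|A| = #|A :\ x :\ f x|.+2.
  by rewrite (cardsD1 x) xA (cardsD1 (f x)) fxA'.
rewrite (big_setD1 x) //= (big_setD1 (f x)) //= IHn ?addrA ?Fx ?eqA //=.
- by rewrite mulrS.
- by rewrite eqA !ltnS in ltAn; apply: ltnW.
move=> y; rewrite !inE => /and3P[yfx yx yA]; have [fyA fyy Fy] := fA y yA.
split=> //; rewrite fyA andbT (inj_eq (can_inj fK)) yx /=.
by apply: contra yfx => /eqP<-; rewrite fK.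
Qed.

(** Two powers of [x] coincide, so the powers are eventually periodic; an
    exponent that is a multiple of the period and large enough works. *)
Lemma expr_idempotent (S : finNzRingType) (x : S) :
  exists k, x ^+ k.+1 * x ^+ k.+1 = x ^+ k.+1.
Proof.
have /injectivePn[i [j ij xij]] : ~~ injectiveb (fun i : 'I_#|S|.+1 => x ^+ i).
  by apply/injectiveP=> /leq_card; rewrite card_ord ltnn.
wlog ltij : i j ij xij / (i < j)%N.
  move=> IH; have [lt|lt|/ord_inj eq] := ltngtP i j; first exact: IH lt.
    by apply: (IH j i) lt; rewrite 1?eq_sym.
  by rewrite eq eqxx in ij.
pose d := (j - i)%N; have d_gt0 : (0 < d)%N by rewrite subn_gt0.
have per m n : (i <= n)%N -> x ^+ (n + m * d) = x ^+ n.
  move=> lein; elim: m => [|m IHm]; first by rewrite addn0.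
  rewrite mulSnr addnA exprD IHm -exprD -{1}(subnK lein) -addnA subnKC ?(ltnW ltij) //.
  by rewrite exprD -xij -exprD subnK.
(* The exponent i.+1 * d is a multiple of the period d and at least i. *)
exists (i.+1 * d).-1; rewrite prednK ?muln_gt0 // -exprD.
by apply: per; rewrite (leq_trans (leqnSn i)) // leq_pmulr.
Qed.

Section Radical.
Variable R : finUnitRingType.
Implicit Types x y u : R.

(** Left multiplication by [x] is injective on a finite set, hence onto. *)
Lemma left_inverse_unit x y : y * x = 1 -> x \is a GRing.unit.
Proof.
move=> yx1.
have inj_x : injective (fun w => x * w).
  by move=> v w /(congr1 ( *%R y)); rewrite !mulrA yx1 !mul1r.
have xw : x * invF inj_x 1 = 1 := f_invF inj_x 1.
have yE : y = invF inj_x 1 by rewrite -[RHS]mul1r -{1}yx1 -mulrA xw mulr1.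
by apply/unitrP; exists y; split=> //; rewrite yE.
Qed.

(** Otherwise the left ideal generated by [1 + x] would lie in a maximal one,
    which contains [x] and therefore [1]. *)
Lemma jacobson_add1_unit x : x \in jacobson R -> 1 + x \is a GRing.unit.
Proof.
move=> xJ; pose I := [set y * (1 + x) | y : R].
have idI : left_ideal I.
  apply/left_idealP; split; first by apply/imsetP; exists 0; rewrite ?mul0r ?inE.
  move=> a _ _ /imsetP[y _ ->] /imsetP[z _ ->]; apply/imsetP.
  by exists (a * y + z); rewrite ?inE // mulrDl mulrA.
have [IT|IT] := eqVneq I [set: R].
  have : 1 \in I by rewrite IT inE.
  by case/imsetP=> y _ /esym; apply: left_inverse_unit.
have propI : left_ideal I && (I != [set: R]) by rewrite idI.
have [M maxM sIM] :=
  @maxset_exists _ (fun J : {set R} => left_ideal J && (J != setT)) _ propI.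
have xM := jacobsonP x xJ M maxM.
have xM1 : 1 + x \in M.
  by apply: (subsetP sIM); apply/imsetP; exists 1; rewrite ?mul1r ?inE.
have /maxsetp/andP[_ /eqP[]] := maxM.
have idM := max_left_ideal_ideal maxM.
apply: left_ideal_setT => //; have /left_idealP[_ lM] := idM.
by rewrite (_ : 1 = (-1) * x + (1 + x)) ?lM // mulN1r addrC addrK.
Qed.

(** A maximal left ideal [M] without [x] would satisfy [R x + M = R], so that
    some [r * x] is congruent to [1] modulo [M]; then so are all its powers,
    although one of them is [0]. *)
Lemma nil_multiples_jacobson x :
  (forall r, exists n, (r * x) ^+ n = 0) -> x \in jacobson R.
Proof.
move=> nil_x; apply/jacobsonP=> M maxM; apply/negP=> xM.
have /andP[idM /eqP[]] := maxsetp maxM; have /left_idealP[M0 lM] := idM.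
apply: left_ideal_setT => //.
pose I := [set r * x + m | r in [set: R], m in M].
have idI : left_ideal I.
  apply/left_idealP; split.
    by apply/imset2P; exists 0 0; rewrite ?inE ?mul0r ?addr0.
  move=> a _ _ /imset2P[r m _ mM ->] /imset2P[s n _ nM ->].
  apply/imset2P; exists (a * r + s) (a * m + n); rewrite ?inE ?lM //.
  by rewrite mulrDr mulrDl !mulrA addrACA.
have sMI : M \subset I.
  by apply/subsetP=> m mM; apply/imset2P; exists 0 m; rewrite ?inE ?mul0r ?add0r.
have [IT|IT] := eqVneq I [set: R]; last first.
  case/maxsetP: maxM => _ /(_ I); rewrite idI IT => /(_ isT sMI) IM.
  have xI : x \in I.
    by apply/imset2P; exists 1 0; rewrite ?inE ?mul1r ?addr0.
  by rewrite IM in xI.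
have : 1 \in I by rewrite IT inE.
case/imset2P=> r m _ mM E; have {E} zM : 1 - r * x \in M by rewrite E addrC addKr.
have [n zn] := nil_x r; rewrite -[1]subr0 -zn.
elim: n {zn} => [|n IHn]; first by rewrite expr0 subrr.
rewrite (_ : 1 - _ = (r * x) ^+ n * (1 - r * x) + (1 - (r * x) ^+ n)) ?lM //.
by rewrite mulrBr mulr1 -exprSr addrC -addrA [RHS]addrC addrA subrK addrC.
Qed.

(** * The unit group modulo the radical *)

(** The subgroup [1 + J], kernel of the reduction of units modulo [J]. *)
Definition principal_units : {set {unit R}} :=
  [set u | val u - 1 \in jacobson R].

Lemma principal_units_group_set : group_set principal_units.
Proof.
apply/group_setP; split=> [|u v]; first by rewrite inE subrr jacobson0.
rewrite !inE /= => uJ vJ.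
rewrite (_ : _ - 1 = val u * (val v - 1) + (val u - 1)) ?jacobson_lin //.
by rewrite mulrBr mulr1 addrA subrK.
Qed.

Canonical principal_units_group := Group principal_units_group_set.

Lemma principal_units_normal : (principal_units <| [set: {unit R}])%g.
Proof.
rewrite /normal subsetT; apply/normsP=> v _; apply/setP=> u.
rewrite mem_conjg !inE /= invrK.
have Uv : val v \is a GRing.unit := valP v.
have -> : val v * (val u * (val v)^-1) - 1 = val v * (val u - 1) * (val v)^-1.
  by rewrite mulrBr mulr1 mulrBl mulrA divrr.
apply/idP/idP=> uJ; last by rewrite jacobson_mulr ?jacobson_mull.
have := jacobson_mull (val v)^-1 (jacobson_mulr (val v) uJ).
by rewrite mulrVK // mulrA mulVr // mul1r.
Qed.

Lemma card_principal_units : #|principal_units| = #|jacobson R|.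
Proof.
pose f (u : {unit R}) := val u - 1.
have inj_f : injective f by move=> u v /addIr/val_inj.
rewrite -(card_imset _ inj_f); apply: eq_card => x.
apply/imsetP/idP=> [[u + ->]|xJ]; first by rewrite inE.
exists (FinRing.unit R (jacobson_add1_unit xJ)); last by rewrite /f /= addrC addKr.
by rewrite inE /= addrC addKr.
Qed.

Lemma card_units : #|[set u : R | u \is a GRing.unit]| = #|[set: {unit R}]|.
Proof.
rewrite -(card_imset _ (val_inj : injective (val : {unit R} -> R))).
apply: eq_card => x; rewrite inE.
apply/idP/imsetP=> [Ux|[u _ ->]]; last exact: valP.
by exists (FinRing.unit R Ux); rewrite ?inE.
Qed.

(** Reducedness of [R / J], phrased inside [R]. *)
Definition reduced_mod_jacobson :=
  forall x, x * x \in jacobson R -> x \in jacobson R.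

(** In characteristic 2, [(1 + x)^2 = 1 + x^2]: square-zero elements of [R / J]
    correspond to units whose class modulo [1 + J] has order at most two, and
    Cauchy's theorem detects such classes in a group of even order. *)
Lemma odd_index_principal_units : 2%:R = 0 :> R ->
  odd #|[set: {unit R}] : principal_units|%g <-> reduced_mod_jacobson.
Proof.
move=> two0; have nPU := principal_units_normal.
have addxx x : x + x = 0 by rewrite -mulr2n -mulr_natr two0 mulr0.
have oppE x : - x = x by apply/eqP; rewrite eq_sym -addr_eq0 addxx.
rewrite -(card_quotient (normal_norm nPU)).
have NPU (u : {unit R}) : u \in 'N(principal_units)%g.
  by have /subsetP sN := normal_norm nPU; apply: sN; rewrite inE.
have sqrB1 x : (x - 1) * (x - 1) = x * x - 1.
  by rewrite !oppE mulrDr mulr1 mulrDl mul1r -addrA (addrA x) addxx add0r.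
split=> [oddQ x x2J | redJ].
- have U2 : (1 + x) * (1 + x) = 1 + x * x.
    by rewrite mulrDr mulr1 mulrDl mul1r -addrA (addrA x) addxx add0r.
  have Ux : 1 + x \is a GRing.unit.
    have U1 := jacobson_add1_unit x2J.
    apply: (@left_inverse_unit _ ((1 + x * x)^-1 * (1 + x))).
    by rewrite -mulrA U2 mulVr.
  pose u := FinRing.unit R Ux; pose c := coset principal_units u.
  have cQ : c \in ([set: {unit R}] / principal_units)%g.
    by rewrite mem_quotient ?inE.
  have c2 : (c ^+ 2 = 1)%g.
    rewrite /c -morphX //=; apply: coset_id.
    by rewrite inE FinRing.val_unitX /= expr2 U2 addrC addKr.
  have c1 : #[c]%g == 1%N.
    rewrite -dvdn1 -(eqP (_ : coprime 2 #|([set: {unit R}] / principal_units)%g|)).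
      by rewrite dvdn_gcd order_dvdn c2 eqxx order_dvdG.
    by rewrite coprime2n.
  rewrite order_eq1 in c1; have := coset_idr (NPU u) (eqP c1).
  by rewrite inE /= addrC addKr.
- apply/negbNE/negP=> evenQ.
  have [|c cQ oc] := @Cauchy _ 2 ([set: {unit R}] / principal_units)%G isT.
    by rewrite dvdn2.
  have [u Nu _ cE] := morphimP cQ.
  have uPU : u \in principal_units.
    rewrite inE; apply: redJ; rewrite sqrB1.
    have : (coset principal_units (u ^+ 2) = 1)%g.
      by rewrite morphX //= -cE -oc expg_order.
    by move/(coset_idr (NPU _)); rewrite inE FinRing.val_unitX expr2.
  by move: oc; rewrite cE /= coset_id // order1.
Qed.

End Radical.

(** * Sums of units *)

Section UnitSum.
Variable R : finUnitRingType.
Implicit Types x y u : R.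

Let U := [set u : R | u \is a GRing.unit].

Lemma unit_sumE : unit_sum R = \sum_(u in U) u.
Proof. by apply: eq_bigl => u; rewrite inE. Qed.

Lemma unit_sum_mull u : u \is a GRing.unit -> u * unit_sum R = unit_sum R.
Proof.
move=> Uu; rewrite /unit_sum [RHS](reindex_inj (mulrI Uu)) mulr_sumr.
by apply: eq_bigl => v; rewrite unitrMr.
Qed.

Lemma unit_sum_mulr u : u \is a GRing.unit -> unit_sum R * u = unit_sum R.
Proof.
move=> Uu; rewrite /unit_sum [RHS](reindex_inj (mulIr Uu)) mulr_suml.
by apply: eq_bigl => v; rewrite unitrMl.
Qed.

(** If [2 <> 0], no unit is its own opposite, and the units cancel in pairs. *)
Lemma unit_sum_char2 : unit_sum R != 0 -> 2%:R = 0 :> R.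
Proof.
apply: contra_neq_eq => two_n0.
rewrite unit_sumE (@sum_paired _ _ -%R _ 0) ?mul0rn //; first exact: opprK.
move=> u; rewrite !inE => Uu; rewrite unitrN subrr; split=> //.
apply: contra two_n0 => /eqP Nu; rewrite -(mulrK Uu 2%:R) mulr_natl mulr2n.
by rewrite -{1}Nu addNr mul0r.
Qed.

Hypothesis two0 : 2%:R = 0 :> R.

Let addxx x : x + x = 0.
Proof. by rewrite -mulr2n -mulr_natr two0 mulr0. Qed.

(** Translation by [e] preserves the units, as [u + e = u (1 + u^-1 e)]. *)
Lemma unit_sum_jacobson e : e \in jacobson R -> e != 0 ->
  unit_sum R = e *+ #|U|./2.
Proof.
move=> eJ e_n0; rewrite unit_sumE (@sum_paired _ _ (fun x => x + e) _ e) //.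
  by move=> x; rewrite -addrA addxx addr0.
move=> u; rewrite !inE => Uu; split.
- rewrite (_ : u + e = u * (1 + u^-1 * e)) ?unitrMr //.
    by rewrite jacobson_add1_unit ?jacobson_mull.
  by rewrite mulrDr mulr1 mulVKr.
- by apply: contra e_n0 => /eqP/(canRL (addKr u)) ->; rewrite addNr.
- by rewrite addrA addxx add0r.
Qed.

Lemma mulrn_char2 x n : x *+ n = if odd n then x else 0.
Proof.
rewrite -{1}[n]odd_double_half mulrnDr -mul2n mulrnA mulr2n addxx mul0rn addr0.
by case: odd.
Qed.

(** [1 + x] is a unit, being its own inverse, and it fixes the sum. *)
Lemma unit_sum_sqrt0 x : x * x = 0 -> unit_sum R * x = 0 /\ x * unit_sum R = 0.
Proof.
move=> x2; have U1 : 1 + x \is a GRing.unit.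
  apply: (@left_inverse_unit _ _ (1 + x)).
  by rewrite mulrDr mulr1 mulrDl mul1r x2 addr0 -addrA addxx addr0.
split; apply: (addrI (unit_sum R)); rewrite addr0.
  by rewrite -[in RHS](unit_sum_mulr U1) mulrDr mulr1.
by rewrite -[in RHS](unit_sum_mull U1) mulrDl mul1r.
Qed.

(** Let [T] be the sum and [e] an idempotent power of [r T].  Since [T T = 0],
    [e T = 0].  The element [e s (1 - e)] has square zero, so it is killed by
    [T] on the right, which gives [e s T = e s (1 - e) T = 0] for all [s].
    As [e] is itself of the form [s T] and idempotent, [e = 0]; hence all
    multiples [r T] are nilpotent. *)
Lemma unit_sum_even_jacobson : ~~ odd #|U| -> unit_sum R \in jacobson R.
Proof.
set T := unit_sum R => evenU.
have TT : T * T = 0.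
  rewrite {1}/T unit_sumE mulr_suml (eq_bigr (fun _ => T)).
    by rewrite sumr_const mulrn_char2 (negPf evenU).
  by move=> u; rewrite inE; apply: unit_sum_mull.
apply: nil_multiples_jacobson => r; have [k] := expr_idempotent (r * T).
set e := (r * T) ^+ k.+1 => ee; exists k.+1; rewrite -/e.
have eT : e * T = 0 by rewrite /e exprSr -!mulrA TT !mulr0.
have [] := @unit_sum_sqrt0 (e * ((r * T) ^+ k * r) * (1 - e)).
  rewrite -!mulrA (mulrA (1 - e)) mulrBl mul1r ee subrr mul0r !mulr0 //.
move=> _; rewrite -mulrA mulrBl mul1r -/T eT subr0 -!mulrA => eq0.
by rewrite -ee {2}/e exprSr.
Qed.

End UnitSum.

(** * Corner rings and finite domains *)

Section Corner.
Variable S : finNzRingType.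

(** The corner [S e] is a ring with unit [e], not a subring of [S], so its ring
    structure is built by hand; bundling the idempotent with its properties
    lets the instances be found from the type [corner e] alone. *)
Record central_idempotent := CentralIdempotent {
  cidem : S;
  cidem_idem : cidem * cidem = cidem;
  cidem_central : forall x, x * cidem = cidem * x;
  cidem_neq0 : cidem != 0 }.

Variable e : central_idempotent.

Record corner := Corner { corner_val : S; _ : corner_val * cidem e == corner_val }.

HB.instance Definition _ := [isSub for corner_val].
HB.instance Definition _ := [Finite of corner by <:].

Lemma cornerP (x : corner) : val x * cidem e = val x.
Proof. exact: eqP (valP x). Qed.

Fact corner_proj_subproof x : x * cidem e * cidem e == x * cidem e.
Proof. by rewrite -mulrA cidem_idem. Qed.
Definition corner_proj x := Corner (corner_proj_subproof x).

Definition corner_zero := corner_proj 0.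
Definition corner_one := corner_proj 1.
Definition corner_opp (x : corner) := corner_proj (- val x).
Definition corner_add (x y : corner) := corner_proj (val x + val y).
Definition corner_mul (x y : corner) := corner_proj (val x * val y).

Fact corner_addE x y : val (corner_add x y) = val x + val y.
Proof. by rewrite /= mulrDl !cornerP. Qed.
Fact corner_mulE x y : val (corner_mul x y) = val x * val y.
Proof. by rewrite /= -mulrA !cornerP. Qed.
Fact corner_oneE : val corner_one = cidem e.
Proof. by rewrite /= mul1r. Qed.

Fact corner_addA : associative corner_add.
Proof. by move=> x y z; apply: val_inj; rewrite !corner_addE addrA. Qed.
Fact corner_addC : commutative corner_add.
Proof. by move=> x y; apply: val_inj; rewrite !corner_addE addrC. Qed.
Fact corner_add0 : left_id corner_zero corner_add.
Proof. by move=> x; apply: val_inj; rewrite corner_addE /= mul0r add0r. Qed.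
Fact corner_addN : left_inverse corner_zero corner_opp corner_add.
Proof.
by move=> x; apply: val_inj; rewrite corner_addE /= mulNr cornerP addNr mul0r.
Qed.

HB.instance Definition _ :=
  GRing.isZmodule.Build corner corner_addA corner_addC corner_add0 corner_addN.

Fact corner_mulA : associative corner_mul.
Proof. by move=> x y z; apply: val_inj; rewrite !corner_mulE mulrA. Qed.
Fact corner_mul1 : left_id corner_one corner_mul.
Proof.
move=> x; apply: val_inj.
by rewrite corner_mulE corner_oneE -cidem_central cornerP.
Qed.
Fact corner_mulr1 : right_id corner_one corner_mul.
Proof.
by move=> x; apply: val_inj; rewrite corner_mulE corner_oneE cornerP.
Qed.
Fact corner_mulDl : left_distributive corner_mul corner_add.
Proof.
by move=> x y z; apply: val_inj; rewrite !(corner_mulE, corner_addE) mulrDl.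
Qed.
Fact corner_mulDr : right_distributive corner_mul corner_add.
Proof.
by move=> x y z; apply: val_inj; rewrite !(corner_mulE, corner_addE) mulrDr.
Qed.
Fact corner_one_neq0 : corner_one != 0.
Proof.
apply/negP=> /eqP/(congr1 val); rewrite corner_oneE /= mul0r.
exact/eqP/cidem_neq0.
Qed.

HB.instance Definition _ := GRing.Zmodule_isNzRing.Build corner
  corner_mulA corner_mul1 corner_mulr1 corner_mulDl corner_mulDr
  corner_one_neq0.

End Corner.

Section FieldOfDomain.
Variable S : finNzRingType.
Hypothesis domS : forall x y : S, x * y = 0 -> (x == 0) || (y == 0).

(** The carrier and the ring structure are those of [S] up to conversion: a
    ring morphism to [S] is a ring morphism to this field. *)
Definition finite_domain_field : finFieldType :=
  let unitM := FinRing.isNzRing.Build S in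
  let unitS : finUnitRingType := HB.pack S unitM in
  @FinDomainFieldType unitS domS.

End FieldOfDomain.

(** * Finite reduced rings *)

Definition reduced (S : pzRingType) := forall x : S, x * x = 0 -> x = 0.

Section Reduced.
Variable S : finNzRingType.
Hypothesis redS : reduced S.
Implicit Types e f g x : S.

(** From [x ^+ n.+2 = 0] the element [x ^+ n.+1] has square zero. *)
Lemma reduced_exp x n : x ^+ n = 0 -> x = 0.
Proof.
have [m] := ubnP n; elim: m => // m IHm in n *; case: n => [_|[_|n]].
- by rewrite expr0 => /eqP; rewrite oner_eq0.
- by rewrite expr1.
rewrite ltnS => ltnm xn; apply: (IHm n.+1) => //; apply: redS.
by rewrite -exprD addSnnS exprD xn mulr0.
Qed.

(** [e x (1 - e)] and [(1 - e) x e] have square zero. *)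
Lemma reduced_idempotent_central e x : e * e = e -> x * e = e * x.
Proof.
move=> ee.
have kill f g y : f * g = 0 -> g * f = 0 -> f * y * g = 0.
  move=> fg gf; apply: redS.
  by rewrite -!mulrA (mulrA g) gf mul0r !mulr0.
have e1 : e * (1 - e) = 0 by rewrite mulrBr mulr1 ee subrr.
have e2 : (1 - e) * e = 0 by rewrite mulrBl mul1r ee subrr.
have /eqP := kill _ _ x e1 e2; rewrite mulrBr mulr1 subr_eq0 => /eqP ->.
have /eqP := kill _ _ x e2 e1; rewrite mulrBl mul1r mulrBl subr_eq0.
by move=> /eqP.
Qed.

Definition primitive_idempotents : {set S} :=
  [set e | [&& e * e == e, e != 0 & [forall f, (f * f == f) && (f != 0) &&
     (f * e == f) ==> (f == e)]]].

Lemma primitiveP e :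
  reflect [/\ e * e = e, e != 0 &
             forall f, f * f = f -> f != 0 -> f * e = f -> f = e]
          (e \in primitive_idempotents).
Proof.
rewrite inE; apply: (iffP and3P) => [[/eqP ee e0 /forallP pe]|[ee e0 pe]].
  split=> // f ff f0 fe; apply/eqP.
  by have := pe f; rewrite ff fe f0 !eqxx.
split=> //; first exact/eqP.
apply/forallP=> f; apply/implyP=> /andP[/andP[/eqP ff f0] /eqP fe].
exact/eqP/pe.
Qed.

Lemma primitive_orthogonal e f :
  e \in primitive_idempotents -> f \in primitive_idempotents ->
  e * f = if e == f then e else 0.
Proof.
move=> /primitiveP[ee e0 pe] /primitiveP[ff f0 pf].
have [<-//|nef] := eqVneq e f; apply/eqP; apply: contraNT nef => ef0.
have fe : f * e = e * f by rewrite (reduced_idempotent_central e ff).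
have idef : e * f * (e * f) = e * f.
  by rewrite -mulrA (mulrA f) fe -mulrA ff mulrA ee.
have <- : e * f = e by apply: pe; rewrite // -mulrA fe mulrA ee.
by apply/eqP; apply: pf; rewrite // -mulrA ff.
Qed.

(** A nonzero idempotent below [g] whose corner has the least cardinality is
    primitive. *)
Lemma exists_primitive g : g * g = g -> g != 0 ->
  exists2 e, e \in primitive_idempotents & e * g = e.
Proof.
move=> gg g0.
pose P f := [&& f * f == f, f != 0 & f * g == f].
have Pg : P g by rewrite /P gg g0 !eqxx.
pose size_of f := #|[set x | x * f == x]|.
case: (@arg_minnP S g P size_of Pg) => e /and3P[/eqP ee e0 /eqP eg] min_e.
exists e => //; apply/primitiveP; split=> // f ff f0 fe.
have Pf : P f by rewrite /P ff f0 -fe -mulrA eg !eqxx.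
have /eqP : [set x | x * f == x] == [set x | x * e == x].
  rewrite eqEcard min_e // andbT; apply/subsetP=> x; rewrite !inE => /eqP <-.
  by rewrite -mulrA fe.
move/setP/(_ e); rewrite !inE ee eqxx => /eqP.
by rewrite (reduced_idempotent_central _ ff) fe.
Qed.

(** The complement [1 - g] of the sum [g] is an idempotent orthogonal to all
    primitive idempotents, so no primitive idempotent lies below it. *)
Lemma sum_primitive : \sum_(e in primitive_idempotents) e = 1.
Proof.
set g := \sum_(e in _) e.
have gP e : e \in primitive_idempotents -> g * e = e.
  move=> eP; rewrite mulr_suml (bigD1 e) //= primitive_orthogonal // eqxx.
  rewrite big1 ?addr0 // => f /andP[fP nfe].
  by rewrite primitive_orthogonal // (negPf nfe).
have gg : g * g = g by rewrite {2}/g mulr_sumr; apply: eq_bigr.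
pose h := 1 - g; have hh : h * h = h.
  by rewrite /h mulrBr mulr1 mulrBl mul1r gg subrr subr0.
have [/eqP|h0] := eqVneq h 0; first by rewrite subr_eq0 => /eqP.
have [e eP he] := exists_primitive hh h0; have /primitiveP[_ /eqP[]] := eP.
by rewrite -he (reduced_idempotent_central _ hh) /h mulrBl mul1r gP // subrr.
Qed.

Lemma primitive_idem e : e \in primitive_idempotents -> e * e = e.
Proof. by case/primitiveP. Qed.

Lemma primitive_neq0 e : e \in primitive_idempotents -> e != 0.
Proof. by case/primitiveP. Qed.

Definition primitive_central (i : 'I_#|primitive_idempotents|) :=
  CentralIdempotent (primitive_idem (enum_valP i))
    (fun x => reduced_idempotent_central x (primitive_idem (enum_valP i)))
    (primitive_neq0 (enum_valP i)).

(** A nonzero [x] of the corner has an idempotent power in the corner; it is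
    nonzero by reducedness, so it is the unit [e], and [x] is no zero
    divisor. *)
Lemma primitive_corner_domain i (x y : corner (primitive_central i)) :
  x * y = 0 -> (x == 0) || (y == 0).
Proof.
move=> xy; have [//|x0] := eqVneq x 0; apply/eqP.
have val0 : val (0 : corner (primitive_central i)) = 0 by rewrite /= mul0r.
have valM (a b : corner (primitive_central i)) : val (a * b) = val a * val b.
  exact: corner_mulE.
have valx0 : val x != 0.
  by apply: contra x0 => /eqP vx; apply/eqP/val_inj; rewrite vx val0.
have [k kk] := expr_idempotent (val x).
have xe : val x ^+ k.+1 = cidem (primitive_central i).
  have /primitiveP[_ _ pe] := enum_valP i.
  apply: pe => //; first by apply: contra valx0 => /eqP/reduced_exp ->.
  by rewrite exprSr -mulrA (cornerP x).
have kill v : v * cidem (primitive_central i) = v -> val x * v = 0 -> v = 0.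
  by rewrite cidem_central => ev xv; rewrite -ev -xe exprSr -mulrA xv mulr0.
by apply: val_inj; rewrite val0; apply: kill; rewrite ?cornerP // -valM xy val0.
Qed.

Definition primitive_field i : finFieldType :=
  finite_domain_field (@primitive_corner_domain i).

Definition primitive_decomp (x : S) :
    prod_ring (fun i => corner (primitive_central i)) :=
  [ffun i => corner_proj (primitive_central i) x].

Fact primitive_decomp_zmod : zmod_morphism primitive_decomp.
Proof.
by move=> x y; apply/ffunP=> i; rewrite !ffunE; apply: val_inj;
  rewrite corner_addE /= mulrBl [in RHS]mulNr -[in RHS]mulrA
    (cidem_idem (primitive_central i)).
Qed.

Fact primitive_decomp_monoid : monoid_morphism primitive_decomp.
Proof.
split; first by apply/ffunP=> i; rewrite !ffunE.
move=> x y; apply/ffunP=> i; rewrite !ffunE; apply: val_inj.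
rewrite corner_mulE /= -mulrA -[RHS]mulrA; congr (x * _).
by rewrite mulrA -(cidem_central (primitive_central i)) -mulrA
   (cidem_idem (primitive_central i)).
Qed.

HB.instance Definition _ := GRing.isZmodMorphism.Build _ _ primitive_decomp
  primitive_decomp_zmod.
HB.instance Definition _ := GRing.isMonoidMorphism.Build _ _ primitive_decomp
  primitive_decomp_monoid.

(** The inverse adds up the components: the primitive idempotents sum to [1]
    and are orthogonal. *)
Lemma primitive_decomp_bij : bijective primitive_decomp.
Proof.
exists (fun g : prod_ring (fun i => corner (primitive_central i)) =>
          \sum_i val (g i)) => [x|g].
  under eq_bigr do rewrite ffunE /=.
  by rewrite -mulr_sumr -(big_enum_val id) sum_primitive mulr1.
apply/ffunP=> i; rewrite ffunE; apply: val_inj; rewrite /= mulr_suml.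
rewrite (bigD1 i) //= cornerP big1 ?addr0 // => j nji.
have orth : cidem (primitive_central j) * enum_val i = 0.
  by rewrite primitive_orthogonal ?enum_valP // (inj_eq enum_val_inj) (negPf nji).
by rewrite -[X in X * _](cornerP (g j)) -mulrA orth mulr0.
Qed.

Lemma reduced_prod_fields :
  exists (d : nat) (F : 'I_d -> finFieldType),
    ring_isomorphic S (prod_ring (fun i => F i)).
Proof.
exists #|primitive_idempotents|, primitive_field.
exists primitive_decomp; exact: primitive_decomp_bij.
Qed.

End Reduced.

(** * Reducedness and the quotient by the radical *)

Section Quotient.
Local Open Scope quotient_scope.
Variable R : finUnitRingType.

HB.instance Definition _ : isCountable (quo_jacobson R) :=
  CanIsCountable (@reprK _ (quo_jacobson R)).
HB.instance Definition _ : isFinite (quo_jacobson R) :=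
  CanIsFinite (@reprK _ (quo_jacobson R)).
Lemma quo_jacobson_eq0 (x : R) : (\pi_(quo_jacobson R) x == 0) = (x \in jacobson R).
Proof. by rewrite -(raddf0 \pi_(quo_jacobson R)) quo_jacobson_eq subr0. Qed.

Lemma quo_jacobson_char2 : 2%:R = 0 :> R -> 2%:R = 0 :> quo_jacobson R.
Proof.
by move=> two0; rewrite -(rmorph_nat \pi_(quo_jacobson R)) two0 rmorph0.
Qed.

Lemma reduced_mod_jacobsonP :
  reduced_mod_jacobson R <-> reduced (quo_jacobson R).
Proof.
split=> [redJ x | redQ x xJ].
  elim/quotW: x => x; rewrite -[_ * _](quo_pi_mul x x) => /eqP; rewrite quo_jacobson_eq0.
  by move/redJ; rewrite -quo_jacobson_eq0 => /eqP.
rewrite -quo_jacobson_eq0; apply/eqP/redQ; rewrite -[_ * _]quo_pi_mul.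
by apply/eqP; rewrite quo_jacobson_eq0.
Qed.

Lemma reduced_mod_jacobson_prod_fields : reduced_mod_jacobson R ->
  exists (d : nat) (F : 'I_d -> finFieldType),
    ring_isomorphic (quo_jacobson R) (prod_ring (fun i => F i)).
Proof. by move=> /reduced_mod_jacobsonP redQ; apply: reduced_prod_fields. Qed.

Lemma reduced_mod_jacobson0 : jacobson R = [set 0] ->
  reduced_mod_jacobson R <-> reduced R.
Proof.
by move=> J0; split=> red x; have := red x; rewrite J0 !inE => H /eqP/H/eqP.
Qed.

End Quotient.

Lemma reduced_sub (A B : pzRingType) (phi : {rmorphism A -> B}) :
  injective phi -> reduced B -> reduced A.
Proof.
move=> inj redB x xx; apply: inj; rewrite rmorph0; apply: redB.
by rewrite -rmorphM xx rmorph0.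
Qed.

Lemma reduced_prod (I : finType) (F : I -> idomainType) :
  reduced (prod_ring (fun i => F i)).
Proof.
move=> f /ffunP ff; apply/ffunP=> i; have /eqP := ff i; rewrite !ffunE.
by rewrite mulf_eq0 orbb => /eqP.
Qed.

Lemma prod_ring_char2 (A : pzRingType) (I : finType) (F : I -> finFieldType)
    (phi : {rmorphism A -> prod_ring (fun i => F i)}) :
  2%:R = 0 :> A -> forall i, 2%N \in [pchar F i].
Proof.
move=> two0 i; rewrite inE /=.
have /ffunP/(_ i) : phi 2%:R = 0 by rewrite two0 rmorph0.
by rewrite rmorph_nat mulr2n !ffunE -mulr2n => ->.
Qed.

(** * Separating the factors with two elements *)

Section TwoElementFields.

Lemma card2_field (K : finFieldType) : #|K| = 2%N ->
  forall x : K, x = 0 \/ x = 1.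
Proof.
move=> K2 x; have [->|x0] := eqVneq x 0; [by left | right].
apply/eqP; apply: contraT => x1.
have uniq01x : uniq [:: 0; 1; x].
  by rewrite /= !inE negb_or ![_ == x]eq_sym x0 x1 eq_sym oner_eq0.
by have := max_card (mem [:: 0; 1; x]); rewrite K2 (card_uniqP uniq01x).
Qed.

(** The isomorphism onto ['F_2] when [K] has two elements. *)
Definition to_F2 (K : finFieldType) (x : K) : 'F_2 := (x != 0)%:R.

Variables (d : nat) (F : 'I_d -> finFieldType).
Hypothesis charF : forall i, 2%N \in [pchar F i].

Let B := [set i | #|F i| == 2%N].

Definition large_factor (j : 'I_#|~: B|) : finFieldType := F (enum_val j).

Definition split_F2 (h : prod_ring (fun i => F i)) :
    semisimple_model #|B| large_factor :=
  ([ffun i => to_F2 (h (enum_val i))], [ffun j => h (enum_val j)]).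

Let F2_01 i : i \in B -> forall x : F i, x = 0 \/ x = 1.
Proof. by rewrite inE => /eqP; apply: card2_field. Qed.

Let addF i : 1 + 1 = 0 :> F i.
Proof. by rewrite -mulr2n (pcharf0 (charF i)). Qed.

Fact split_F2_zmod : zmod_morphism split_F2.
Proof.
move=> g h; congr (_, _); apply/ffunP=> i; rewrite !ffunE //.
rewrite /to_F2; have := F2_01 (enum_valP i).
move: (g _) (h _) (addF (enum_val i)) => x y two0 F01.
have [->|->] := F01 x; have [->|->] := F01 y;
  by rewrite ?subr0 ?sub0r ?subrr ?oppr_eq0 ?eqxx ?oner_eq0 //=; apply/val_inj.
Qed.

Fact split_F2_monoid : monoid_morphism split_F2.
Proof.
split.
  by congr (_, _); apply/ffunP=> i; rewrite !ffunE // /to_F2 oner_eq0.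
move=> g h; congr (_, _); apply/ffunP=> i; rewrite !ffunE //.
by rewrite /to_F2 mulf_eq0 negb_or -natrM mulnb.
Qed.

HB.instance Definition _ := GRing.isZmodMorphism.Build _ _ split_F2
  split_F2_zmod.
HB.instance Definition _ := GRing.isMonoidMorphism.Build _ _ split_F2
  split_F2_monoid.

Lemma split_F2_inj : injective split_F2.
Proof.
move=> g h [/ffunP eq1 /ffunP eq2]; apply/ffunP=> i.
have [iB|iB] := boolP (i \in B); last first.
  have iC : i \in ~: B by rewrite inE.
  rewrite -(enum_rankK_in iC iC).
  by have := eq2 (enum_rank_in iC i); rewrite !ffunE.
rewrite -(enum_rankK_in iB iB); have := eq1 (enum_rank_in iB i).
rewrite !ffunE /to_F2; move: (enum_rank_in _ _) => j.
have F01 := F2_01 (enum_valP j).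
have [->|->] := F01 (g (enum_val j)); have [->|->] := F01 (h (enum_val j));
  by rewrite ?eqxx ?oner_eq0 //= => /eqP.
Qed.

(** Surjectivity is obtained by counting, which avoids transporting elements
    along equalities of indices in a dependent product. *)
Lemma split_F2_bij : bijective split_F2.
Proof.
pose A : finType := {dffun forall i, F i}.
pose C : finType := ({ffun 'I_#|B| -> 'F_2} * {dffun forall j, large_factor j})%type.
apply: (@inj_card_bij A C); first exact: split_F2_inj.
rewrite card_prod card_ffun !card_ord /=.
rewrite !card_dep_ffun !foldrE !big_map -!enumT !big_enum /=.
rewrite (bigID (mem B)) /= leq_mul //.
  rewrite (eq_bigr (fun _ => 2%N)); last by move=> i; rewrite inE => /eqP.
  by rewrite prod_nat_const.
rewrite (eq_bigl (mem (~: B))); last by move=> i; rewrite !inE.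
by rewrite (big_enum_val (fun i => #|F i|)).
Qed.

Lemma ring_isomorphic_split (A : pzRingType) :
  ring_isomorphic A (prod_ring (fun i => F i)) ->
  ring_isomorphic A (semisimple_model #|B| large_factor).
Proof.
case=> phi bij_phi; exists (split_F2 \o phi).
exact: bij_comp split_F2_bij bij_phi.
Qed.

Lemma split_F2_data j : 2%N \in [pchar large_factor j] /\ (2 < #|large_factor j|)%N.
Proof.
split; first exact: charF.
have := enum_valP j; rewrite !inE ltn_neqAle eq_sym => -> /=.
have := max_card (mem [set 0; 1 : large_factor j]).
by rewrite cards2 eq_sym oner_eq0.
Qed.

End TwoElementFields.

(** * The value of the sum of the units *)

Lemma rmorph_unit (A : unitRingType) (B : pzRingType) (phi : {rmorphism A -> B})
    (x : A) (y : B) : bijective phi -> phi x * y = 1 -> y * phi x = 1 ->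
  x \is a GRing.unit.
Proof.
case=> psi phiK psiK xy yx; apply/unitrP; exists (psi y).
by split; apply: (can_inj phiK); rewrite rmorphM rmorph1 psiK.
Qed.

(** Multiplication by the unit whose components are [1] on the ['F_2] part and
    some [a i] different from [0] and [1] on the rest fixes the sum. *)
Lemma semisimple_unit_sum (R : finUnitRingType) (r t : nat)
    (F : 'I_t -> finFieldType) (phi : {rmorphism R -> semisimple_model r F}) :
  bijective phi -> (forall i, (2 < #|F i|)%N) ->
  odd #|[set u : R | u \is a GRing.unit]| -> phi (unit_sum R) = (1, 0).
Proof.
move=> bij_phi largeF oddU; rewrite [LHS]surjective_pairing; congr (_, _).
  apply/ffunP=> i; rewrite [RHS]ffunE /unit_sum raddf_sum.
  rewrite (big_morph (fun p : semisimple_model r F => p.1 i) (id1 := 0) (op1 := +%R));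
    last 2 first.
  - by move=> p q; rewrite ffunE.
  - by rewrite ffunE.
  rewrite (eq_bigr (fun _ => 1)).
    rewrite sumr_const -[X in _ *+ X](_ : #|[set u : R | u \is a GRing.unit]| = _).
      by rewrite -[#|_|]odd_double_half oddU mulrnDr -mul2n mulrnA
        pchar_Zp ?mul0rn ?addr0.
    by apply: eq_card => u; rewrite inE.
  move=> u Uu.
  have : (phi u).1 i * (phi u^-1).1 i = 1.
    have : (phi u * phi u^-1).1 i = 1 by rewrite -rmorphM divrr // rmorph1 ffunE.
    by rewrite ffunE.
  by case: ((phi u).1 i) => -[|[|//]] ? H; apply/val_inj; rewrite //= in H *.
(* As F i has more than two elements, the default value 1 is never taken. *)
pose a i : F i := odflt 1 [pick x : F i | (x != 0) && (x != 1)].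
have aP i : (a i != 0) && (a i != 1).
  rewrite /a; case: pickP => //= all01; have := largeF i.
  suff : (#|F i| <= 2)%N by rewrite leqNgt => /negPf->.
  have sub01 : {subset F i <= [:: 0; 1 : F i]}.
    move=> x _; rewrite !inE; have := all01 x; rewrite -negb_or.
    by move=> /negbFE.
  by apply: leq_trans (card_size [:: 0; 1 : F i]); apply/subset_leq_card/subsetP.
pose b : prod_ring (fun i => F i) := [ffun i => a i].
pose b' : prod_ring (fun i => F i) := [ffun i => (a i)^-1].
have bb' : b * b' = 1.
  by apply/ffunP=> i; rewrite !ffunE divff //; case/andP: (aP i).
have b'b : b' * b = 1.
  by apply/ffunP=> i; rewrite !ffunE mulVf //; case/andP: (aP i).
have [psi _ psiK] := bij_phi.
pose w : semisimple_model r F := (1, b); pose w' : semisimple_model r F := (1, b').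
have Uw : psi w \is a GRing.unit.
  by apply: (@rmorph_unit _ _ phi _ w' bij_phi); rewrite psiK;
    congr (_, _); rewrite ?mulr1.
have /(congr1 (fun p => p.2)) : w * phi (unit_sum R) = phi (unit_sum R).
  by rewrite -{1}[w]psiK -rmorphM unit_sum_mull.
move: (phi _) => [p q] /= bq; apply/ffunP=> i; rewrite [RHS]ffunE.
have /eqP := congr1 (fun f : prod_ring _ => f i) bq; rewrite !ffunE.
rewrite -subr_eq0 -[X in _ - X]mul1r -mulrBl mulf_eq0 subr_eq0.
by have /andP[_ /negPf->] := aP i => /eqP.
Qed.

Lemma card_units_jacobson (R : finUnitRingType) :
  #|[set u : R | u \is a GRing.unit]| =
    (#|jacobson R| * #|[set: {unit R}] : principal_units R|%g)%N.
Proof. by rewrite card_units -card_principal_units Lagrange // subsetT. Qed.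

Lemma unit_sum_jacobson2 (R : finUnitRingType) (e : R) :
  2%:R = 0 :> R -> #|jacobson R| = 2%N -> e \in jacobson R -> e != 0 ->
  unit_sum R = if odd #|[set: {unit R}] : principal_units R|%g then e else 0.
Proof.
move=> two0 J2 eJ e0.
by rewrite (unit_sum_jacobson two0 eJ e0) card_units_jacobson J2 mul2n doubleK
  mulrn_char2.
Qed.

Lemma odd_units_semisimple (R : finUnitRingType) :
  2%:R = 0 :> R -> jacobson R = [set 0] -> reduced R ->
  odd #|[set u : R | u \is a GRing.unit]|.
Proof.
move=> two0 J0 redR; rewrite card_units_jacobson J0 cards1 mul1n.
exact/odd_index_principal_units/reduced_mod_jacobson0.
Qed.

(** By [unit_sum_jacobson] the radical is contained in [{0, T}]. *)
Lemma jacobson_unit_sum_neq0 (R : finUnitRingType) : unit_sum R != 0 ->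
  jacobson R = [set 0] \/ #|jacobson R| = 2%N.
Proof.
move=> T0; have two0 := unit_sum_char2 T0.
have sJT : jacobson R \subset [set 0; unit_sum R].
  apply/subsetP=> e eJ; rewrite !inE; have [//|e0] := eqVneq e 0.
  move: T0; rewrite (unit_sum_jacobson two0 eJ e0) mulrn_char2 //.
  by case: odd; rewrite eqxx.
have [TJ|TJ] := boolP (unit_sum R \in jacobson R); [right | left].
  rewrite (_ : jacobson R = [set 0; unit_sum R]) ?cards2 1?eq_sym ?T0 //.
  by apply/eqP; rewrite eqEsubset sJT subUset !sub1set jacobson0.
apply/eqP; rewrite eqEsubset sub1set jacobson0 andbT.
apply/subsetP=> e eJ; have := subsetP sJT e eJ; rewrite !inE.
by case/orP=> // /eqP eT; rewrite eT (negPf TJ) in eJ.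
Qed.

Lemma jacobson_card2 (R : finNzRingType) : #|jacobson R| = 2%N ->
  exists e, [/\ e \in jacobson R, e != 0 & forall x, x \in jacobson R -> x != 0 -> x = e].
Proof.
move=> J2; have : #|jacobson R :\ 0| == 1%N.
  by have := cardsD1 0 (jacobson R); rewrite J2 jacobson0 add1n => -[<-].
case/cards1P=> e eE; exists e.
have : e \in jacobson R :\ 0 by rewrite eE inE.
rewrite !inE => /andP[e0 eJ]; split=> // x xJ x0.
have : x \in jacobson R :\ 0 by rewrite !inE x0.
by rewrite eE inE => /eqP.
Qed.

(** If [J] has two elements, an even index of [1 + J] would make the sum vanish
    ([unit_sum_jacobson2]); if [J = 0] the index is the number of units, and an
    even number of units would put the sum in [J]. *)
Lemma unit_sum_neq0_reduced (R : finUnitRingType) :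
  unit_sum R != 0 -> reduced_mod_jacobson R.
Proof.
move=> T0; have two0 := unit_sum_char2 T0.
apply/(odd_index_principal_units two0).
have [J0|J2] := jacobson_unit_sum_neq0 T0; last first.
  have [e [eJ e0 _]] := jacobson_card2 J2.
  by move: T0; rewrite (unit_sum_jacobson2 two0 J2 eJ e0); case: odd; rewrite ?eqxx.
have := card_units_jacobson R; rewrite J0 cards1 mul1n => <-.
apply: contraNT T0 => /(unit_sum_even_jacobson two0); by rewrite J0 inE.
Qed.

(** A product of fields is reduced, so the index of [1 + J] is odd and the sum
    is the nonzero element of the radical. *)
Lemma nonsemisimple_unit_sum (R : finUnitRingType) : nonsemisimple_case R ->
  exists2 e, unique (fun x : R => x \in jacobson R /\ x <> 0) e & unit_sum R = e.
Proof.
case=> two0 J2 [d [F [charF [phi /bij_inj inj_phi]]]].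
have [e [eJ e0 uniq_e]] := jacobson_card2 J2.
exists e.
  by split=> [|x [xJ /eqP x0]]; [split=> //; apply/eqP | rewrite (uniq_e x)].
rewrite (unit_sum_jacobson2 two0 J2 eJ e0).
suff /(odd_index_principal_units two0)-> : reduced_mod_jacobson R by [].
apply/reduced_mod_jacobsonP/(reduced_sub inj_phi); exact: reduced_prod.
Qed.

Lemma reduced_model (r t : nat) (F : 'I_t -> finFieldType) :
  reduced (semisimple_model r F).
Proof.
move=> [p q] [pp qq]; congr (_, _); last exact: reduced_prod qq.
apply/ffunP=> i; have /ffunP/(_ i)/eqP := pp; rewrite !ffunE.
by rewrite mulf_eq0 orbb => /eqP.
Qed.

Lemma model_char2 (R : finUnitRingType) (r t : nat) (F : 'I_t -> finFieldType)
    (phi : {rmorphism R -> semisimple_model r F}) :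
  injective phi -> (forall i, 2%N \in [pchar F i]) -> 2%:R = 0 :> R.
Proof.
move=> inj charF; apply: inj; rewrite rmorph_nat rmorph0 mulr2n.
congr (_, _); apply/ffunP=> i; rewrite !ffunE -mulr2n; last exact: pcharf0.
exact/val_inj.
Qed.

Lemma semisimple_unit_sumE (R : finUnitRingType) (r t : nat)
    (F : 'I_t -> finFieldType) (phi : {rmorphism R -> semisimple_model r F}) :
  semisimple_data R r F -> bijective phi -> phi (unit_sum R) = (1, 0).
Proof.
move=> [J0 _ dataF] bij_phi; have inj := bij_inj bij_phi.
apply: semisimple_unit_sum => // [i|]; first by case: (dataF i).
have two0 : 2%:R = 0 :> R.
  by apply: model_char2 inj _ => i; case: (dataF i).
exact: odd_units_semisimple two0 J0 (reduced_sub inj (@reduced_model r t F)).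
Qed.

(** If no factor had two elements, the sum would be [(1, 0)] in a ring whose
    first component is trivial, that is, zero. *)
Lemma semisimple_classification (R : finUnitRingType) : unit_sum R != 0 ->
  jacobson R = [set 0] -> semisimple_case R.
Proof.
move=> T0 J0; have two0 := unit_sum_char2 T0.
have redR : reduced R by apply/reduced_mod_jacobson0/unit_sum_neq0_reduced.
have [d [F isoF]] := reduced_prod_fields redR; have [phi _] := isoF.
have charF := prod_ring_char2 phi two0.
have [chi bij_chi] := ring_isomorphic_split charF isoF.
eexists _, _, (large_factor (F := F)); split; last by exists chi.
split=> //; last exact: split_F2_data.
rewrite lt0n; apply: contra_neq T0 => r0.
apply: (bij_inj bij_chi); rewrite rmorph0.
rewrite semisimple_unit_sum //.
  by congr (_, _); apply/ffunP; rewrite r0 => -[].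
- by move=> i; case: (split_F2_data charF i).
- exact: odd_units_semisimple.
Qed.

Theorem proposition2p12 (R : finUnitRingType) :
  [/\ unit_sum R != 0 <-> nonsemisimple_case R \/ semisimple_case R,
      nonsemisimple_case R ->
        exists e : R,
          unique (fun x : R => x \in jacobson R /\ x <> 0) e /\ unit_sum R = e
    & forall (r t : nat) (F : 'I_t -> finFieldType),
        semisimple_data R r F ->
        forall phi : {rmorphism R -> semisimple_model r F},
          bijective phi -> phi (unit_sum R) = (1, 0)].
Proof.
split; last by move=> r t F dataR phi; apply: semisimple_unit_sumE.
- split=> [T0 | [/nonsemisimple_unit_sum[e [[_ /eqP e0] _] ->] // | ]].
  + have two0 := unit_sum_char2 T0.
    have [J0|J2] := jacobson_unit_sum_neq0 T0.
      by right; apply: semisimple_classification.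
    left; split=> //.
    have := unit_sum_neq0_reduced T0.
    case/reduced_mod_jacobson_prod_fields=> d [F [phi bij_phi]].
    exists d, F; split; last by exists phi.
    exact/(prod_ring_char2 phi)/quo_jacobson_char2.
  + case=> r [t [F [dataR [phi bij_phi]]]].
    apply/negP=> /eqP T0; have [_ r_gt0 _] := dataR.
    have := congr1 (fun p : semisimple_model r F => p.1 (Ordinal r_gt0))
      (semisimple_unit_sumE dataR bij_phi).
    by rewrite T0 rmorph0 !ffunE => /eqP; rewrite eq_sym oner_eq0.
- by case/nonsemisimple_unit_sum=> e ue Te; exists e.
Qed.
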